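(* Let $n\ge0$ and $s\in\mathbb{Z}$. (i) Assume all objects in the following identity are defined, i.e. $E_m^{(s)}\ne0$ for $n\le m\le n+3$, $E_m^{(s-1)}\ne0$ for $m=n+1,n+2$, and $E_m^{(s-2)}\ne0$ for $n\le m\le n+2$. Then $$R_{n+3}(z;s)-(z+\varkappa_{n+2}^{(s)})R_{n+2}(z;s)+(\varkappa_{n+1}^{(s)}+\rho_{n+1}^{(s-1)}+\rho_{n+2}^{(s)}+\varkappa_{n+2}^{(s)})zR_{n+1}(z;s)-(\rho_{n+2}^{(s)}+\varkappa_{n+2}^{(s)})(\varkappa_n^{(s)}+\rho_n^{(s-1)})zR_n(z;s)=0.$$ (ii) Assume all objects in the following identity are defined, i.e. $E_m^{(s)}\ne0$ for $n\le m\le n+3$, $E_m^{(s+1)}\ne0$ for $m=n+1,n+2$, and $E_{n+1}^{(s+2)}\neq0$. Then $$S^*_{n+3}(z;s)-(\gamma_{n+2}^{(s)}+\gamma_{n+1}^{(s+1)})zS^*_{n+2}(z;s)-(1-\gamma_{n+1}^{(s+1)}\gamma_{n+1}^{(s)}z^2)S^*_{n+1}(z;s)+(\theta_{n+1}^{(s+1)}+\gamma_{n+1}^{(s+1)})zS^*_n(z;s)=0.$$ Here $$\varkappa_n^{(s)}=-\frac{g_n^{(s-2)}}{g_n^{(s)}},\quad \rho_n^{(s)}=\frac{E_n^{(s+1)}E_{n+1}^{(s-2)}}{E_{n+1}^{(s)}E_n^{(s-1)}},\quad \gamma_n^{(s)}=-\frac{g_n^{(s+1)}}{g_n^{(s)}},\quad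 \theta_n^{(s)}=\frac{E_n^{(s-2)}E_{n+1}^{(s+1)}}{E_{n+1}^{(s)}E_n^{(s-1)}}.$$
   Context: $\mathbb{T}$ is the unit circle, oriented counterclockwise; $w$ is a complex-valued integrable weight on $\mathbb{T}$ with Fourier coefficients $w_k=\int_{\mathbb{T}}\zeta^{-k}w(\zeta)\frac{d\zeta}{2\pi i\zeta}$. For $n\ge1$, $E_n^{(s)}=\det(w_{s+j-2k})_{0\le j,k\le n-1}$ ($j$ row index, $k$ column index), and $E_0^{(s)}=1$. When $E_n^{(s)}\ne0$, $R_n(z;s)$ and $S_n(z;s)$ are the unique monic polynomials of degree $n$ with $\int_{\mathbb{T}}R_n(\zeta^2;s)\zeta^{-m-s}w(\zeta)\frac{d\zeta}{2\pi i\zeta}=0$ and $\int_{\mathbb{T}}S_n(\zeta^{-1};s)\zeta^{2m-s}w(\zeta)\frac{d\zeta}{2\pi i\zeta}=0$ for $0\le m\le n-1$; for $m=n$ both integrals equal $g_n^{(s)}=E_{n+1}^{(s)}/E_n^{(s)}$. The reciprocal polynomial is $S_n^*(z;s)=z^nS_n(z^{-1};s)$. *)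

(* Defs.v *)
From HB Require Import structures.
From mathcomp Require Import all_boot all_order all_algebra.
From mathcomp Require Import all_classical all_reals all_analysis.
From mathcomp Require Import complex.

Set Implicit Arguments.
Unset Strict Implicit.
Unset Printing Implicit Defensive.

Import Order.TTheory GRing.Theory Num.Theory.
Import ComplexField.

Local Open Scope ring_scope.
Local Open Scope complex_scope.

Section Integration.
Variable R : realType.
Local Notation C := R[i].

Definition cis (t : R) : C := cos t +i* sin t.

Definition angles : set R := [set` `[0, 2 * pi]%R].

Definition arc_integral (f : R -> C) : C :=
  (\int[@lebesgue_measure R]_(t in angles) complex.Re (f t))
  +i* (\int[@lebesgue_measure R]_(t in angles) complex.Im (f t)).

(* The integral of f over the counterclockwise unit circle, through zeta = cis t
   and d zeta = i cis t dt. *)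
Definition circle_integral (f : C -> C) : C :=
  arc_integral (fun t => f (cis t) * ('i * cis t)).

(* Integral against d zeta / (2 pi i zeta). *)
Definition circle_mean (f : C -> C) : C :=
  circle_integral (fun z => f z / (2 * (pi : R)%:C * 'i * z)).

(* Integrability on the unit circle with respect to arc length; the values of w
   off the circle play no role. *)
Definition circle_integrable (w : C -> C) : Prop :=
  (@lebesgue_measure R).-integrable angles (fun t => (complex.Re (w (cis t)))%:E) /\
  (@lebesgue_measure R).-integrable angles (fun t => (complex.Im (w (cis t)))%:E).

End Integration.

Section BiorthogonalPolynomials.
Variables (R : realType) (w : R[i] -> R[i]).
Local Notation C := R[i].

Definition fourier (k : int) : C := circle_mean (fun z => z ^ (- k) * w z).

(* E_n^(s); the determinant of the empty matrix is 1. *)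
Definition Edet (n : nat) (s : int) : C :=
  \det (\matrix_(j < n, k < n) fourier (s + j%:Z - 2 * k%:Z)).

Definition g (n : nat) (s : int) : C := Edet n.+1 s / Edet n s.

Definition is_Rpoly (n : nat) (s : int) (p : {poly C}) : Prop :=
  [/\ p \is monic, size p = n.+1 &
      forall m : nat, (m < n)%N ->
        circle_mean (fun z => p.[z ^+ 2] * z ^ (- m%:Z - s) * w z) = 0].

Definition is_Spoly (n : nat) (s : int) (p : {poly C}) : Prop :=
  [/\ p \is monic, size p = n.+1 &
      forall m : nat, (m < n)%N ->
        circle_mean (fun z => p.[z^-1] * z ^ (2 * m%:Z - s) * w z) = 0].

(* Definite descriptions: for integrable w and Edet n s != 0, a unique p satisfies
   the predicate; 0 is returned if there is none. *)
Definition Rpoly (n : nat) (s : int) : {poly C} :=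
  xget 0 [set p | is_Rpoly n s p]%classic.

Definition Spoly (n : nat) (s : int) : {poly C} :=
  xget 0 [set p | is_Spoly n s p]%classic.

(* z^n p(1/z) as a polynomial, so that its value at 0 is the right one. *)
Definition reciprocal (n : nat) (p : {poly C}) : {poly C} :=
  \poly_(i < n.+1) p`_(n - i).

Lemma horner_reciprocal (n : nat) (p : {poly C}) (z : C) :
  (size p <= n.+1)%N -> z != 0 -> (reciprocal n p).[z] = z ^+ n * p.[z^-1].
Proof.
move=> sz_p z0; rewrite (horner_coef_wide _ sz_p) horner_poly.
rewrite (reindex_inj rev_ord_inj) /= mulr_sumr; apply: eq_bigr => i _.
have le_in : (i <= n)%N by rewrite -ltnS.
rewrite subSS subKn // exprVn mulrCA; congr (_ * _).
by rewrite -[X in _ = z ^+ X * _](subnK le_in) exprD mulfK // expf_neq0.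
Qed.

Definition Sstar (n : nat) (s : int) : {poly C} := reciprocal n (Spoly n s).

Definition varkappa (n : nat) (s : int) : C := - (g n (s - 2) / g n s).

Definition rho (n : nat) (s : int) : C :=
  (Edet n (s + 1) * Edet n.+1 (s - 2)) / (Edet n.+1 s * Edet n (s - 1)).

Definition gamma (n : nat) (s : int) : C := - (g n (s + 1) / g n s).

Definition theta (n : nat) (s : int) : C :=
  (Edet n (s - 2) * Edet n.+1 (s + 1)) / (Edet n.+1 s * Edet n (s - 1)).

End BiorthogonalPolynomials.

(* Main.v *)
(** Both recurrences follow one pattern. With moments c_m and mu_m(p) = sum_k p_k c_(m + b k),
    the determinants D_n(s) = det c_(s + a j + b k) are the E_n^(s) for (a, b) = (1, -2) or (-2, 1),
    and the monic p of degree n with mu_(s + a j)(p) = 0 for j < n is R_n or S_n respectively.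
    After the Desnanot-Jacobi identity has put the coefficients in product form, the left-hand
    side q (of the identity for S_n itself in part (ii), before passing to reciprocals) has degree
    at most n + 2, constant term 0, and vanishing moments at n + 2 places with common difference a;
    dividing by X leaves a linear system with a nonsingular matrix, so q = 0. *)

Require Import Defs.
From HB Require Import structures.
From mathcomp Require Import all_boot all_order all_algebra.
From mathcomp Require Import all_classical all_reals all_analysis.
From mathcomp Require Import complex ring zify.

Set Implicit Arguments.
Unset Strict Implicit.
Unset Printing Implicit Defensive.

Import Order.TTheory GRing.Theory Num.Theory.
Import ComplexField.

Local Open Scope ring_scope.
Local Open Scope complex_scope.

(** * Step determinants, moments, and uniqueness from vanishing moments *)

Section Biorthogonality.
Variables (F : fieldType) (c : int -> F).
Implicit Types (a b m s : int) (n : nat) (p q : {poly F}).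

Definition step_mx a b n s : 'M[F]_n :=
  \matrix_(j < n, k < n) c (s + a * j%:Z + b * k%:Z).

(* Locked so that [field] compares determinants syntactically. *)
Definition step_det a b n s := locked (\det (step_mx a b n s)).

Lemma step_detE a b n s : step_det a b n s = \det (step_mx a b n s).
Proof. by rewrite /step_det -lock. Qed.

(** Transposition exchanges the row step and the column step; this is why the R and S families share
    the same determinants. *)
Lemma step_detC a b n s : step_det a b n s = step_det b a n s.
Proof.
by rewrite !step_detE -det_tr; congr (\det _); apply/matrixP=> i j; rewrite !mxE addrAC.
Qed.

(** For Fourier coefficients [c] of [w], this is the circle mean of [p.[z ^ (- b)] * z ^ (- m) * w
    z]. *)
Definition moment b p m := \sum_(k < size p) p`_k * c (m + b * k%:Z).

Lemma moment_wide N b p m : (size p <= N)%N ->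
  moment b p m = \sum_(k < N) p`_k * c (m + b * k%:Z).
Proof.
move=> szp; rewrite /moment (big_ord_widen _ (fun k : nat => p`_k * c (m + b * k%:Z)) szp).
rewrite big_mkcond /=; apply: eq_bigr => k _; case: ltnP => // szk.
by rewrite nth_default ?mul0r.
Qed.

Lemma momentD b p q m : moment b (p + q) m = moment b p m + moment b q m.
Proof.
pose N := maxn (size p) (size q).
rewrite (@moment_wide N _ (p + q)) ?size_polyD //.
rewrite (@moment_wide N _ p) ?leq_maxl // (@moment_wide N _ q) ?leq_maxr //.
by rewrite -big_split; apply: eq_bigr => k _; rewrite coefD mulrDl.
Qed.

Lemma momentZ b x p m : moment b (x *: p) m = x * moment b p m.
Proof.
rewrite (@moment_wide (size p)) ?size_scale_leq // mulr_sumr.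
by apply: eq_bigr => k _; rewrite coefZ mulrA.
Qed.

Lemma momentN b p m : moment b (- p) m = - moment b p m.
Proof. by rewrite -scaleN1r momentZ mulN1r. Qed.

Lemma momentXM b p m : moment b ('X * p) m = moment b p (m + b).
Proof.
rewrite (@moment_wide (size p).+1); last first.
  by rewrite (leq_trans (size_polyMleq _ _)) // size_polyX.
rewrite big_ord_recl coefXM mul0r add0r.
apply: eq_bigr => k _; rewrite coefXM /=; congr (_ * c _).
by rewrite intS; ring.
Qed.

(** The moments are the entries of [step_mx a b n s] times the coefficient vector of [q], and that
    matrix is invertible. *)
Lemma eq0_of_moments a b n s q : step_det a b n s != 0 -> (size q <= n)%N ->
  (forall j, (j < n)%N -> moment b q (s + a * j%:Z) = 0) -> q = 0.
Proof.
move=> D0 szq q0; pose v : 'cV[F]_n := \col_k q`_k.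
have Av : step_mx a b n s *m v = 0.
  apply/matrixP => j k; rewrite !mxE -[RHS](q0 j) // (moment_wide _ _ szq).
  by apply: eq_bigr => i _; rewrite !mxE mulrC.
have v0 : v = 0.
  by rewrite -[v](@mulKmx _ _ _ (step_mx a b n s)) ?Av ?mulmx0 // unitmxE unitfE -step_detE.
apply/polyP => k; rewrite coef0; case: (ltnP k n) => [kn|nk]; last first.
  by rewrite nth_default // (leq_trans szq).
by move/matrixP/(_ (Ordinal kn) 0): v0; rewrite !mxE.
Qed.

(** A zero constant term lets [q] have one more degree: [q] is ['X] times a polynomial of size at
    most [n], whose moments are those of [q] read with the base point moved by [b]. Hence the
    determinant at [s + b]. *)
Lemma eq0_of_moments_coef0 a b n s q : step_det a b n (s + b) != 0 ->
  (size q <= n.+1)%N -> q`_0 = 0 ->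
  (forall j, (j < n)%N -> moment b q (s + a * j%:Z) = 0) -> q = 0.
Proof.
move=> D0 szq q00 q0.
have qX : q = 'X * (\poly_(k < n) q`_k.+1).
  apply/polyP => -[|k]; rewrite coefXM //= coef_poly; case: ltnP => // nk.
  by rewrite nth_default // (leq_trans szq).
rewrite qX (@eq0_of_moments a b n (s + b) (\poly_(k < n) q`_k.+1)) ?mulr0 ?size_poly //.
by move=> j jn; rewrite addrAC -momentXM -qX q0.
Qed.

(* The cofactors do not depend on the last row of the matrix, so pairing them
   with another row computes the determinant with its last row replaced. *)
Definition cofactor_poly a b n s : {poly F} :=
  \poly_(k < n.+1) cofactor (step_mx a b n.+1 s) ord_max (inord k).

Lemma size_cofactor_poly a b n s : (size (cofactor_poly a b n s) <= n.+1)%N.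
Proof. exact: size_poly. Qed.

Lemma cofactor_poly_lead a b n s : (cofactor_poly a b n s)`_n = step_det a b n s.
Proof.
rewrite coef_poly ltnSn /cofactor inordK // -signr_odd addnn odd_double mul1r step_detE.
congr (\det _); apply/matrixP => i j; rewrite !mxE lift_max.
by rewrite [inord n](_ : _ = ord_max) ?lift_max //; apply: val_inj; rewrite /= inordK.
Qed.

(** Deleting the first column instead of the last moves the base point by [b] and costs the sign of
    the corner cofactor. *)
Lemma cofactor_poly_const a b n s :
  (cofactor_poly a b n s)`_0 = (-1) ^+ n * step_det a b n (s + b).
Proof.
rewrite coef_poly /= /cofactor inordK // addn0 step_detE; congr (_ * \det _).
apply/matrixP => i j; rewrite !mxE lift_max.
rewrite [inord 0](_ : _ = ord0) ?lift0; last by apply: val_inj; rewrite /= inordK.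
by congr c; rewrite intS; ring.
Qed.

Lemma moment_cofactor_poly a b n s m : moment b (cofactor_poly a b n s) m =
  \sum_(k < n.+1) c (m + b * k%:Z) * cofactor (step_mx a b n.+1 s) ord_max k.
Proof.
rewrite (moment_wide _ _ (size_cofactor_poly _ _ _ _)); apply: eq_bigr => k _.
by rewrite coef_poly ltn_ord inord_val mulrC.
Qed.

(** This is the last column of [A *m \adj A = (\det A)%:M]: replacing the last row by row [j < n]
    repeats a row. *)
Lemma moment_cofactor_poly_window a b n s j : (j <= n)%N ->
  moment b (cofactor_poly a b n s) (s + a * j%:Z) = step_det a b n.+1 s *+ (j == n).
Proof.
rewrite -ltnS => jn; rewrite moment_cofactor_poly step_detE.
have /matrixP/(_ (Ordinal jn) ord_max) := mul_mx_adj (step_mx a b n.+1 s).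
rewrite !mxE -val_eqE /= => <-.
by apply: eq_bigr => k _; rewrite !mxE.
Qed.

(** The replacing row precedes rows [0] to [n - 1]; moving it from the bottom to the top gives the
    step matrix at [s - a] and the sign [(-1) ^+ n]. *)
Lemma moment_cofactor_poly_before a b n s :
  moment b (cofactor_poly a b n s) (s - a) = (-1) ^+ n * step_det a b n.+1 (s - a).
Proof.
rewrite moment_cofactor_poly step_detE (expand_det_row _ ord0) mulr_sumr.
apply: eq_bigr => k _; rewrite mxE mulr0 addr0 [RHS]mulrCA; congr (_ * _).
rewrite /cofactor mulrA -exprD; congr (_ * \det _).
apply/matrixP => i j; rewrite !mxE lift_max lift0; congr c.
by rewrite intS; ring.
Qed.

(** A combination [q] of three cofactor polynomials is shown to be zero by its moments; its next
    moment, the one with [j = n], is then the identity. *)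
Lemma desnanot_jacobi a b n s : step_det a b n (s + a + b) != 0 ->
  step_det a b n.+2 s * step_det a b n (s + a + b) =
  step_det a b n.+1 s * step_det a b n.+1 (s + a + b)
  - step_det a b n.+1 (s + a) * step_det a b n.+1 (s + b).
Proof.
set t := s + a + b => Dt.
(* The first two terms cancel in degree [n.+1], the first and third in the constant term. *)
pose q := step_det a b n t *: cofactor_poly a b n.+1 s
  - step_det a b n.+1 s *: ('X * cofactor_poly a b n t)
  + step_det a b n.+1 (s + b) *: cofactor_poly a b n (s + a).
have mq j : (j <= n)%N -> moment b q (s + a + a * j%:Z) =
    (step_det a b n t * step_det a b n.+2 s
     - step_det a b n.+1 s * step_det a b n.+1 t
     + step_det a b n.+1 (s + b) * step_det a b n.+1 (s + a)) *+ (j == n).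
  move=> jn; rewrite !momentD momentN !momentZ momentXM.
  have -> : s + a + a * j%:Z + b = t + a * j%:Z by rewrite /t; ring.
  rewrite (moment_cofactor_poly_window _ _ t) // (moment_cofactor_poly_window _ _ (s + a)) //.
  have -> : s + a + a * j%:Z = s + a * j.+1%:Z by rewrite intS; ring.
  rewrite moment_cofactor_poly_window // eqSS.
  by case: (j == n); rewrite ?mulr1n // !mulr0n; ring.
have q0 : q = 0.
  apply: (@eq0_of_moments_coef0 a b n (s + a)) => // [||j jn].
  - apply/leq_sizeP => k; rewrite leq_eqVlt => /orP[/eqP<-|nk].
      rewrite coefD coefB !coefZ coefXM /= !cofactor_poly_lead.
      rewrite nth_default ?size_cofactor_poly //; ring.
    rewrite coefD coefB !coefZ coefXM; case: k nk => //= k nk.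
    by rewrite !nth_default ?(leq_trans (size_cofactor_poly _ _ _ _)) // ?mulr0 ?subr0 ?addr0 // ltnW.
  - rewrite coefD coefB !coefZ coefXM /= !cofactor_poly_const exprS -/t; ring.
  - by rewrite mq ?(ltnW jn) // (ltn_eqF jn).
have := mq n (leqnn n); rewrite q0 eqxx mulr1n.
rewrite -[X in moment b X _](scale0r 0) momentZ mul0r => /esym/eqP.
by rewrite addr_eq0 subr_eq => /eqP; rewrite mulrC => ->; ring.
Qed.

(* Locked so that the scaling stays invisible to rewriting. *)
Definition orth_poly a b n s : {poly F} :=
  locked ((step_det a b n s)^-1 *: cofactor_poly a b n s).

Lemma orth_polyE a b n s :
  orth_poly a b n s = (step_det a b n s)^-1 *: cofactor_poly a b n s.
Proof. by rewrite /orth_poly -lock. Qed.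

Definition is_orth_poly a b n s p := [/\ p \is monic, size p = n.+1 &
  forall j, (j < n)%N -> moment b p (s + a * j%:Z) = 0].

(** * Monic orthogonal polynomials: coefficients, moments, uniqueness *)

Section OrthPoly.
Variables (a b : int) (n : nat) (s : int).
Hypothesis Dn0 : step_det a b n s != 0.

Let P := orth_poly a b n s.

Lemma orth_poly_coef k : (n <= k)%N -> P`_k = (k == n)%:R.
Proof.
rewrite leq_eqVlt => /orP[/eqP<-|nk]; rewrite /P orth_polyE coefZ.
  by rewrite eqxx cofactor_poly_lead mulVf.
by rewrite (gtn_eqF nk) nth_default ?mulr0 // (leq_trans (size_cofactor_poly _ _ _ _)).
Qed.

Lemma size_orth_poly : size P = n.+1.
Proof.
apply/eqP; rewrite eqn_leq; apply/andP; split.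
  by apply/leq_sizeP => k nk; rewrite orth_poly_coef ?(ltnW nk) // gtn_eqF.
by rewrite ltnNge; apply/negP => /leq_sizeP/(_ n (leqnn n))/eqP;
   rewrite orth_poly_coef // eqxx oner_eq0.
Qed.

Lemma orth_poly_const : P`_0 = (-1) ^+ n * step_det a b n (s + b) / step_det a b n s.
Proof. by rewrite /P orth_polyE coefZ cofactor_poly_const mulrC. Qed.

Lemma moment_orth_poly j : (j < n)%N -> moment b P (s + a * j%:Z) = 0.
Proof.
move=> jn; rewrite /P orth_polyE momentZ moment_cofactor_poly_window ?(ltnW jn) //.
by rewrite (ltn_eqF jn) mulr0.
Qed.

Lemma moment_orth_poly_last :
  moment b P (s + a * n%:Z) = step_det a b n.+1 s / step_det a b n s.
Proof. by rewrite /P orth_polyE momentZ moment_cofactor_poly_window // eqxx mulr1n mulrC. Qed.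

Lemma moment_orth_poly_before :
  moment b P (s - a) = (-1) ^+ n * step_det a b n.+1 (s - a) / step_det a b n s.
Proof. by rewrite /P orth_polyE momentZ moment_cofactor_poly_before mulrC. Qed.

(** Two monic candidates differ by a polynomial of size at most [n] with [n] vanishing moments, so
    [eq0_of_moments] applies. *)
Lemma orth_polyP p : is_orth_poly a b n s p <-> p = P.
Proof.
split=> [[pm szp p0]|->].
  apply/eqP; rewrite -subr_eq0; apply/eqP.
  apply: (eq0_of_moments Dn0) => [|j jn]; last first.
    by rewrite momentD momentN p0 // moment_orth_poly // subr0.
  apply/leq_sizeP => k nk; rewrite coefB orth_poly_coef //.
  move: nk; rewrite leq_eqVlt => /orP[/eqP<-|nk].
    by rewrite eqxx; move: pm; rewrite monicE lead_coefE szp => /eqP->; rewrite subrr.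
  by rewrite (gtn_eqF nk) subr0 nth_default // szp.
split; [|exact: size_orth_poly|exact: moment_orth_poly].
by rewrite monicE lead_coefE size_orth_poly orth_poly_coef // eqxx.
Qed.

End OrthPoly.

(** * The recurrence for R, with coefficients in product form *)

Section RecurrenceR.

Local Notation E := (step_det 1 (- 2)).
Local Notation P := (orth_poly 1 (- 2)).

(** The leading terms of [P n.+3 s] and ['X * P n.+2 s] cancel. Of the coefficients, [x] makes the
    constant term vanish, [z] the last moment, and then [y] the first; the moments in between vanish
    termwise. *)
Lemma recurrence_R n s :
  E n s != 0 -> E n.+1 s != 0 -> E n.+2 s != 0 -> E n.+3 s != 0 ->
  E n.+2 (s - 1) != 0 -> E n.+2 (s - 2) != 0 ->
  P n.+3 s - ('X + (- (E n.+3 (s - 2) * E n.+2 s / (E n.+2 (s - 2) * E n.+3 s)))%:P) * P n.+2 s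
  + (- (E n.+1 s * E n.+3 (s - 1) / (E n.+2 (s - 1) * E n.+2 s))
     - E n.+3 (s - 2) * E n.+1 (s - 1) / (E n.+2 (s - 1) * E n.+2 (s - 2)))%:P * 'X * P n.+1 s
  - (E n.+3 (s - 2) * E n s / (E n.+2 (s - 2) * E n.+1 s))%:P * 'X * P n s = 0.
Proof.
move=> E0 E1 E2 E3 F2 G2.
set x := - (_ / _); set y := _ - _ / _; set z := _ * _ / _.
pose q := P n.+3 s - 'X * P n.+2 s - x *: P n.+2 s + y *: ('X * P n.+1 s)
  - z *: ('X * P n s).
suff q_eq0 : q = 0 by rewrite -[RHS]q_eq0 /q -!mul_polyC; ring.
have size_q : (size q <= n.+3)%N.
  apply/leq_sizeP => k nk; rewrite !(coefD, coefN, coefZ, coefXM).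
  case: k nk => //= k nk; rewrite !orth_poly_coef //; try lia.
  rewrite !eqSS (@gtn_eqF n.+1 k) // (@gtn_eqF n k (ltnW nk)).
  by rewrite !mulr0 !subr0 addr0 subrr.
have q0 : q`_0 = 0.
  rewrite !(coefD, coefN, coefZ, coefXM) /= !orth_poly_const // !exprS /x.
  by field; rewrite E2 E3 G2.
have mom_q m : moment (- 2) q m = moment (- 2) (P n.+3 s) m - moment (- 2) (P n.+2 s) (m - 2)
    - x * moment (- 2) (P n.+2 s) m + y * moment (- 2) (P n.+1 s) (m - 2)
    - z * moment (- 2) (P n s) (m - 2).
  by rewrite !(momentD, momentN, momentZ, momentXM).
(* Starting at [s + 1] makes the relevant determinant [E n.+2 (s - 1)]. *)
apply: (@eq0_of_moments_coef0 1 (- 2) n.+2 (s + 1)) => // [|j jn].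
  by have -> : s + 1 - 2 = s - 1 by ring.
have window k i : (i < k)%N -> E k s != 0 -> moment (- 2) (P k s) (s + i%:Z) = 0.
  by move=> ik Ek; rewrite -[i%:Z]mul1r moment_orth_poly.
have last k : E k s != 0 -> moment (- 2) (P k s) (s + k%:Z) = E k.+1 s / E k s.
  by move=> Ek; rewrite -[k%:Z]mul1r moment_orth_poly_last.
rewrite mom_q mul1r.
have -> : s + 1 + j%:Z = s + j.+1%:Z by rewrite intS; ring.
(* For [j = 0] the factor ['X] moves the index to [s - 1], just before the orthogonality window. *)
rewrite (window n.+3) //; case: j jn => [_|j jn].
  have -> : s + 1%:Z - 2 = s - 1 by ring.
  rewrite (window n.+2) // !moment_orth_poly_before // !exprS /y /z.
  by field; rewrite E0 E1 E2 F2 G2.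
have -> : s + j.+2%:Z - 2 = s + j%:Z by rewrite !intS; ring.
rewrite (window n.+2 j) //; last lia.
(* At the last index only [P n.+2 s] and [P n s] contribute, each just past its window. *)
move: jn; rewrite !ltnS leq_eqVlt => /orP[/eqP->|jn].
  rewrite (window n.+1) // !last // /x /z; field.
  by rewrite E0 E1 E2 E3 G2.
by rewrite !window //; [ring|lia..].
Qed.

End RecurrenceR.

(** * The recurrence for S before passing to reciprocals *)

Section RecurrenceS.

Local Notation E := (step_det (- 2) 1).
Local Notation P := (orth_poly (- 2) 1).

(** Here [P n.+3 s] and ['X * ('X * P n.+1 s)] cancel in top degree. The coefficient [z] makes the
    first moment vanish, [y] the last, and then [x] the constant term. *)
Lemma recurrence_S n s :
  E n s != 0 -> E n.+1 s != 0 -> E n.+2 s != 0 -> E n.+3 s != 0 ->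
  E n.+1 (s + 1) != 0 -> E n.+2 (s + 1) != 0 -> E n.+1 (s + 2) != 0 ->
  P n.+3 s
  + (E n.+3 (s + 1) * E n.+2 s / (E n.+2 (s + 1) * E n.+3 s)
     + E n.+2 (s + 2) * E n.+1 (s + 1) / (E n.+1 (s + 2) * E n.+2 (s + 1)))%:P * P n.+2 s
  + (E n.+2 (s + 2) * E n.+1 s / (E n.+1 (s + 2) * E n.+2 s))%:P * P n.+1 s
  - 'X * ('X * P n.+1 s)
  - (E n.+2 (s + 2) * E n s / (E n.+1 s * E n.+1 (s + 2)))%:P * ('X * ('X * P n s)) = 0.
Proof.
move=> E0 E1 E2 E3 F1 F2 G1.
set x := _ + _ / _; set y := _ * _ / _; set z := _ * _ / _.
rewrite !mul_polyC.
set q := (X in X = 0).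
have size_q : (size q <= n.+3)%N.
  apply/leq_sizeP => k nk; rewrite !(coefD, coefN, coefZ, coefXM).
  case: k nk => //= -[//|k] nk /=; rewrite !orth_poly_coef //; try lia.
  rewrite !eqSS (@gtn_eqF n k) // (@gtn_eqF n k.+1 (leqW nk)).
  by rewrite !mulr0 !addr0 subrr subr0.
have q0 : q`_0 = 0.
  rewrite !(coefD, coefN, coefZ, coefXM) /= !orth_poly_const // !exprS /x /y.
  by field; rewrite E1 E2 E3 F2 G1.
have mom_q m : moment 1 q m = moment 1 (P n.+3 s) m + x * moment 1 (P n.+2 s) m
    + y * moment 1 (P n.+1 s) m - moment 1 (P n.+1 s) (m + 1 + 1)
    - z * moment 1 (P n s) (m + 1 + 1).
  by rewrite !(momentD, momentN, momentZ, momentXM).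
apply: (@eq0_of_moments_coef0 (- 2) 1 n.+2 s) => // j jn.
have window k i : (i < k)%N -> E k s != 0 -> moment 1 (P k s) (s + - 2 * i%:Z) = 0.
  by move=> ik Ek; rewrite moment_orth_poly.
rewrite mom_q (window n.+3) ?(leqW jn) // (window n.+2) //; case: j jn => [_|j jn].
  rewrite (window n.+1 0) //.
  (* Two factors ['X] move the index by one full row step, to the place just before the window. *)
  have -> : s + - 2 * 0%:Z + 1 + 1 = s - (- 2) by ring.
  rewrite !moment_orth_poly_before //.
  have -> : s - (- 2) = s + 2 by ring.
  rewrite !exprS /z; field.
  by rewrite E0 E1 G1.
have -> : s + - 2 * j.+1%:Z + 1 + 1 = s + - 2 * j%:Z by rewrite intS; ring.
move: jn; rewrite !ltnS leq_eqVlt => /orP[/eqP->|jn].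
  rewrite (window n.+1 n) // !moment_orth_poly_last // /y /z; field.
  by rewrite E0 E1 E2 G1.
by rewrite !window //; [ring|lia..].
Qed.

End RecurrenceS.

End Biorthogonality.

(** * Integrability and linearity of the mean on the circle *)

Section Circle.
Variable R : realType.
Local Notation C := R[i].
Local Notation mu := (@lebesgue_measure R).

Definition arc_integrable (f : R -> C) : Prop :=
  mu.-integrable (@angles R) (EFin \o (fun t => complex.Re (f t))) /\
  mu.-integrable (@angles R) (EFin \o (fun t => complex.Im (f t))).

Implicit Types (f : R -> C) (w : C -> C) (x : C).

Lemma measurable_angles : measurable (@angles R).
Proof. exact: measurable_itv. Qed.
Hint Resolve measurable_angles : core.

(** The real and imaginary parts of [h t * f t] are combinations of products of a bounded measurable
    function and an integrable one. *)
Lemma arc_integrableM (h : R -> C) f :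
  measurable_fun setT (fun t => complex.Re (h t)) ->
  measurable_fun setT (fun t => complex.Im (h t)) ->
  (forall t, `|complex.Re (h t)| <= 1 /\ `|complex.Im (h t)| <= 1) ->
  arc_integrable f -> arc_integrable (fun t => h t * f t).
Proof.
move=> rm im h1 [fr fi].
have bounded_mul (u v : R -> R) : measurable_fun setT u -> (forall t, `|u t| <= 1) ->
    mu.-integrable (@angles R) (EFin \o v) ->
    mu.-integrable (@angles R) (EFin \o (fun t => u t * v t)).
  move=> um u1 vi; apply: (integrableMr _ _ _ vi) => //; first exact: measurable_funTS.
  by exists 1; split=> // M M1 t _; exact: le_trans (u1 t) (ltW M1).
have r1 t := (h1 t).1; have i1 t := (h1 t).2; split.
  apply: (eq_integrable _ _ _ _ (integrableB _ (bounded_mul _ _ rm r1 fr)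
    (bounded_mul _ _ im i1 fi))) => // t _.
  by rewrite /=; case: (h t) (f t) => ? ? [].
apply: (eq_integrable _ _ _ _ (integrableD _ (bounded_mul _ _ rm r1 fi)
  (bounded_mul _ _ im i1 fr))) => // t _.
by rewrite /=; case: (h t) (f t) => ? ? [].
Qed.

Lemma arc_integrableD f1 f2 : arc_integrable f1 -> arc_integrable f2 ->
  arc_integrable (fun t => f1 t + f2 t).
Proof.
move=> [r1 i1] [r2 i2]; split.
  apply: (eq_integrable _ _ _ _ (integrableD _ r1 r2)) => // t _.
  by rewrite /= raddfD.
apply: (eq_integrable _ _ _ _ (integrableD _ i1 i2)) => // t _.
by rewrite /= raddfD.
Qed.

Lemma arc_integrableZ x f : arc_integrable f -> arc_integrable (fun t => x * f t).
Proof.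
case: x => xr xi [fr fi]; split.
  apply: (eq_integrable _ _ _ _ (integrableB _ (integrableZl _ xr fr) (integrableZl _ xi fi))) => // t _.
  by rewrite /=; case: (f t).
apply: (eq_integrable _ _ _ _ (integrableD _ (integrableZl _ xr fi) (integrableZl _ xi fr))) => // t _.
by rewrite /=; case: (f t).
Qed.

Lemma arc_integralD f1 f2 : arc_integrable f1 -> arc_integrable f2 ->
  arc_integral (fun t => f1 t + f2 t) = arc_integral f1 + arc_integral f2.
Proof.
move=> [r1 i1] [r2 i2]; rewrite /arc_integral.
rewrite [RHS](_ : _ = (\int[mu]_(t in @angles R) (complex.Re (f1 t)) + \int[mu]_(t in @angles R) (complex.Re (f2 t))) +i* (\int[mu]_(t in @angles R) (complex.Im (f1 t)) + \int[mu]_(t in @angles R) (complex.Im (f2 t)))) //.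
rewrite -!RintegralD //; congr (_ +i* _); by apply: eq_Rintegral => t _; rewrite raddfD.
Qed.

Lemma arc_integralZ x f : arc_integrable f ->
  arc_integral (fun t => x * f t) = x * arc_integral f.
Proof.
case: x => xr xi [fr fi].
rewrite /arc_integral.
rewrite [RHS](_ : _ = (xr * \int[mu]_(t in @angles R) (complex.Re (f t)) - xi * \int[mu]_(t in @angles R) (complex.Im (f t))) +i* (xr * \int[mu]_(t in @angles R) (complex.Im (f t)) + xi * \int[mu]_(t in @angles R) (complex.Re (f t)))) //.
have iZ y h : mu.-integrable (@angles R) (EFin \o h) ->
    mu.-integrable (@angles R) (EFin \o (fun t => y * h t)) by exact: integrableZl.
rewrite -!RintegralZl // -RintegralB -?RintegralD //; try exact: iZ.
by congr (_ +i* _); apply: eq_Rintegral => t _; case: (f t).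
Qed.

Lemma arc_integral_sum N (x : 'I_N -> C) (f : 'I_N -> R -> C) :
  (forall k, arc_integrable (f k)) ->
  arc_integral (fun t => \sum_k x k * f k t) = \sum_k x k * arc_integral (f k).
Proof.
move=> fi.
(* Integrability of the sum is carried through the induction because additivity of the integral
   requires it. *)
suff: arc_integrable (fun t => \sum_k x k * f k t) /\
    arc_integral (fun t => \sum_k x k * f k t) = \sum_k x k * arc_integral (f k) by case.
elim: N x f fi => [|N IHN] x f fi.
  rewrite big_ord0; under eq_fun do rewrite big_ord0.
  have i0 : arc_integrable (fun=> 0 : C) by split; exact: integrable0.
  split=> //; rewrite -[RHS](mul0r (arc_integral (fun=> 0))) -arc_integralZ //.
  by under [in RHS]eq_fun do rewrite mul0r.
rewrite big_ord_recl; under eq_fun do rewrite big_ord_recl.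
have [IH1 IH2] := IHN (fun k => x (lift ord0 k)) (fun k => f (lift ord0 k)) (fun k => fi _).
split; first exact: arc_integrableD (arc_integrableZ _ (fi _)) IH1.
by rewrite -IH2 arc_integralD ?arc_integralZ //; exact: arc_integrableZ.
Qed.

Lemma cis_neq0 (t : R) : cis t != 0.
Proof.
apply/eqP => -[c0 s0]; have := cos2Dsin2 t.
by rewrite c0 s0 expr0n addr0 => /esym/eqP; rewrite oner_eq0.
Qed.

Lemma cisV (t : R) : (cis t)^-1 = cos t -i* sin t.
Proof. by rewrite -[LHS]/(invc (cis t)) /= cos2Dsin2 !divr1. Qed.

(** The factor ['i * cis t] of the parametrization cancels against the denominator, leaving a
    constant multiple of the integral over angles. *)
Lemma circle_meanE (f : C -> C) : circle_mean f =
  arc_integral (fun t => (2 * (pi : R)%:C)^-1 * f (cis t)).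
Proof.
congr arc_integral; apply: funext => t.
rewrite -[RHS]mulr1 -[X in _ = _ * X](mulfV (_ : 'i * cis t != 0)).
  by rewrite -[_ * 'i * _]mulrA invfM; ring.
by rewrite mulf_neq0 ?cis_neq0 // neq0Ci.
Qed.

Lemma circle_mean_sum N (x : 'I_N -> C) (h : 'I_N -> C -> C) (f : C -> C) :
  (forall k, circle_integrable (h k)) ->
  (forall t, f (cis t) = \sum_k x k * h k (cis t)) ->
  circle_mean f = \sum_k x k * circle_mean (h k).
Proof.
move=> hi fE; rewrite circle_meanE; under eq_bigr do rewrite circle_meanE.
rewrite -arc_integral_sum; last by move=> k; exact: arc_integrableZ (hi k).
congr arc_integral; apply: funext => t; rewrite fE mulr_sumr.
by apply: eq_bigr => k _; rewrite mulrCA.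
Qed.

Lemma circle_integrable_exp w (k : int) :
  circle_integrable w -> circle_integrable (fun z => z ^ k * w z).
Proof.
move=> wi; have cosm : measurable_fun setT (@cos R).
  by apply: measurable_realfun.continuous_measurable_fun; exact: continuous_cos.
have sinm : measurable_fun setT (@sin R).
  by apply: measurable_realfun.continuous_measurable_fun; exact: continuous_sin.
case: k => n.
  elim: n => [|n IHn]; first by under eq_fun do rewrite expr0z mul1r.
  under eq_fun do rewrite -exprnP exprS -mulrA.
  apply: (@arc_integrableM (@cis R)) IHn => //= t.
  by rewrite cos_max sin_max.
have step (v : C -> C) : circle_integrable v -> circle_integrable (fun z => z^-1 * v z).
  move=> vi; apply: (@arc_integrableM (fun t => (cis t)^-1)) vi.
  - by under eq_fun do rewrite cisV.
  - by under eq_fun do rewrite cisV; exact: measurableT_comp.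
  - by move=> t; rewrite cisV /= normrN cos_max sin_max.
(* [Negz n] stands for [- n.+1], so the base case already carries one inverse factor. *)
elim: n => [|n IHn]; first exact: step.
under eq_fun do rewrite NegzE -exprnN exprS invfM -mulrA.
by apply: step; move: IHn; under eq_fun do rewrite NegzE -exprnN.
Qed.
End Circle.

(** * Product forms of the recurrence coefficients *)

Section CoefficientIdentities.
Variables (F : fieldType) (E : nat -> int -> F).
(** The Desnanot-Jacobi identity for steps [1] and [- 2], where [s + a + b] is [s - 1]. *)
Hypothesis DJ : forall n s, E n (s - 1) != 0 ->
  E n.+2 s * E n (s - 1) = E n.+1 s * E n.+1 (s - 1) - E n.+1 (s + 1) * E n.+1 (s - 2).

Local Notation h n s := (E n.+1 s / E n s).
Implicit Types (n : nat) (s : int).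

(** Over a common denominator, the right-hand side of [DJ] at [s] factors out of the numerator. *)
Lemma rho_add_varkappa n s :
  E n.+1 s != 0 -> E n.+2 s != 0 -> E n (s - 1) != 0 ->
  E n.+1 (s - 1) != 0 -> E n.+1 (s - 2) != 0 ->
  (E n.+1 (s + 1) * E n.+2 (s - 2)) / (E n.+2 s * E n.+1 (s - 1))
    + - (h n.+1 (s - 2) / h n.+1 s) =
  - (E n.+2 (s - 2) * E n (s - 1) / (E n.+1 (s - 1) * E n.+1 (s - 2))).
Proof.
move=> E1 E2 F0 F1 G1; rewrite -[E n (s - 1)](mulKf E2) DJ //.
by field; rewrite E1 E2 F1 G1.
Qed.

Lemma varkappa_add_rho n s :
  E n s != 0 -> E n.+1 s != 0 -> E n.+1 (s - 1) != 0 -> E n (s - 2) != 0 ->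
  - (h n (s - 2) / h n s)
    + (E n (s - 1 + 1) * E n.+1 (s - 1 - 2)) / (E n.+1 (s - 1) * E n (s - 1 - 1)) =
  - (E n s * E n.+2 (s - 1) / (E n.+1 (s - 1) * E n.+1 s)).
Proof.
move=> E0 E1 F1 G0; have s2 : s - 1 - 1 = s - 2 by ring.
have := @DJ n (s - 1); rewrite s2 subrK => /(_ G0) DJs.
(* [DJ] at [s - 1] eliminates the determinant of largest size. *)
rewrite -[E n.+2 (s - 1)](mulfK G0) DJs.
by field; rewrite E0 E1 F1 G0.
Qed.

Lemma coef_R_product n s :
  E n.+1 s != 0 -> E n.+1 (s - 1) != 0 -> E n.+2 (s - 1) != 0 -> E n.+2 (s - 2) != 0 ->
  - (E n.+3 (s - 2) * E n.+1 (s - 1) / (E n.+2 (s - 1) * E n.+2 (s - 2)))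
    * - (E n s * E n.+2 (s - 1) / (E n.+1 (s - 1) * E n.+1 s)) =
  E n.+3 (s - 2) * E n s / (E n.+2 (s - 2) * E n.+1 s).
Proof. by move=> E1 F1 F2 G2; field; rewrite E1 F1 F2 G2. Qed.

Lemma theta_add_gamma n s :
  E n s != 0 -> E n.+1 s != 0 -> E n.+1 (s + 1) != 0 ->
  E n.+2 (s + 1) != 0 -> E n.+1 (s + 2) != 0 ->
  (E n.+1 (s + 1 - 2) * E n.+2 (s + 1 + 1)) / (E n.+2 (s + 1) * E n.+1 (s + 1 - 1))
    + - (h n.+1 (s + 1 + 1) / h n.+1 (s + 1)) =
  - (E n.+2 (s + 2) * E n s / (E n.+1 s * E n.+1 (s + 2))).
Proof.
move=> E0 E1 F1 F2 G1; have s2 : s + 1 + 1 = s + 2 by ring.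
have := @DJ n (s + 1); rewrite s2 addrK => /(_ E0) DJs.
(* [DJ] at [s + 1] eliminates the determinant of smallest size. *)
rewrite -[E n s](mulKf F2) DJs.
by field; rewrite E1 F1 F2 G1.
Qed.

Lemma gamma_mul_gamma n s :
  E n.+1 s != 0 -> E n.+2 s != 0 -> E n.+1 (s + 1) != 0 ->
  E n.+2 (s + 1) != 0 -> E n.+1 (s + 2) != 0 ->
  - (h n.+1 (s + 1 + 1) / h n.+1 (s + 1)) * - (h n.+1 (s + 1) / h n.+1 s) =
  E n.+2 (s + 2) * E n.+1 s / (E n.+1 (s + 2) * E n.+2 s).
Proof.
move=> E1 E2 F1 F2 G1; have -> : s + 1 + 1 = s + 2 by ring.
by field; rewrite E1 E2 F1 F2 G1.
Qed.

End CoefficientIdentities.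

(** * Algebra of reversed polynomials *)

Section Reciprocal.
Variable R : realType.
Implicit Types p q : {poly R[i]}.

Lemma reciprocalD n p q : reciprocal n (p + q) = reciprocal n p + reciprocal n q.
Proof.
by apply/polyP => i; rewrite coefD !coef_poly coefD; case: ifP => _; rewrite ?addr0.
Qed.

Lemma reciprocalZ n x p : reciprocal n (x *: p) = x *: reciprocal n p.
Proof.
by apply/polyP => i; rewrite coefZ !coef_poly coefZ; case: ifP => _; rewrite ?mulr0.
Qed.

Lemma reciprocalN n p : reciprocal n (- p) = - reciprocal n p.
Proof. by rewrite -scaleN1r reciprocalZ scaleN1r. Qed.

Lemma reciprocal0 n : reciprocal n (0 : {poly R[i]}) = 0.
Proof. by rewrite -[X in reciprocal n X](scale0r 0) reciprocalZ scale0r. Qed.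

Lemma reciprocalXM n p : reciprocal n.+1 ('X * p) = reciprocal n p.
Proof.
apply/polyP => i; rewrite !coef_poly coefXM subn_eq0.
by case: (ltnP i n.+1) => [lt_in|_]; [rewrite (leqW lt_in) subSn|case: ifP].
Qed.

(** Reversal at a degree one too high shifts all coefficients up; the size bound makes the new
    constant term zero. *)
Lemma reciprocal_widen n p : (size p <= n.+1)%N -> reciprocal n.+1 p = 'X * reciprocal n p.
Proof.
move=> szp; apply/polyP => -[|i]; rewrite coefXM !coef_poly /=.
  by rewrite subn0 nth_default.
by rewrite ltnS subSS.
Qed.

End Reciprocal.

(** * Circle means as moments of the Fourier coefficients *)

Section FourierMoments.
Variables (R : realType) (w : R[i] -> R[i]).
Hypothesis w_int : circle_integrable w.
Implicit Types (p : {poly R[i]}) (n : nat) (s : int).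

(** Expanding [p] gives a combination of Fourier integrals. It is used with [e = 2] for R and
    [e = - 1] for S. *)
Lemma circle_mean_moment (e k : int) p (f : R[i] -> R[i]) :
  (forall z, z != 0 -> f z = p.[z ^ e] * z ^ (- k) * w z) ->
  circle_mean f = moment (fourier w) (- e) p k.
Proof.
move=> fE; apply: (@circle_mean_sum _ _ (fun i : 'I_(size p) => p`_i)
  (fun i z => z ^ (- (k + - e * i%:Z)) * w z)) => [i|t].
  exact: circle_integrable_exp.
have z0 := cis_neq0 t; rewrite fE // horner_coef !mulr_suml.
apply: eq_bigr => i _; rewrite -!mulrA; congr (_ * _); rewrite mulrA; congr (_ * _).
rewrite exprnP exprz_exp -expfzDr //; congr (_ ^ _); ring.
Qed.

Lemma EdetE n s : Edet w n s = step_det (fourier w) 1 (- 2) n s.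
Proof.
rewrite step_detE; congr (\det _); apply/matrixP => i j; by rewrite !mxE mul1r mulNr.
Qed.

Lemma RpolyE n s : Edet w n s != 0 ->
  Rpoly w n s = orth_poly (fourier w) 1 (- 2) n s.
Proof.
rewrite EdetE => E0.
have RP p : is_Rpoly w n s p <-> p = orth_poly (fourier w) 1 (- 2) n s.
  rewrite -(orth_polyP E0); split=> -[pm szp p0]; split=> // m mn.
    rewrite -(p0 m mn) (@circle_mean_moment 2 (s + 1 * m%:Z) p) // => z _.
    by congr (_ * _ ^ _ * _); ring.
  rewrite (@circle_mean_moment 2 (s + 1 * m%:Z) p) ?p0 // => z _.
  by congr (_ * _ ^ _ * _); ring.
(* Exactly one polynomial satisfies the predicate, so the default value [0] of [xget] is not what is
   returned. *)
by apply: xget_unique => [|q]; rewrite /= ?RP // => /RP.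
Qed.

Lemma SpolyE n s : Edet w n s != 0 ->
  Spoly w n s = orth_poly (fourier w) (- 2) 1 n s.
Proof.
rewrite EdetE step_detC => E0.
have SP p : is_Spoly w n s p <-> p = orth_poly (fourier w) (- 2) 1 n s.
  have mE m : circle_mean (fun z => p.[z^-1] * z ^ (2 * m%:Z - s) * w z) =
      moment (fourier w) 1 p (s + - 2 * m%:Z).
    rewrite (@circle_mean_moment (- 1) (s + - 2 * m%:Z) p) ?opprK // => z _.
    by congr (_ * _ ^ _ * _); ring.
  by rewrite -(orth_polyP E0); split=> -[pm szp p0]; split=> // m mn; move: (p0 m mn);
     rewrite mE.
by apply: xget_unique => [|q]; rewrite /= ?SP // => /SP.
Qed.

Lemma Edet_desnanot_jacobi n s : Edet w n (s - 1) != 0 ->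
  Edet w n.+2 s * Edet w n (s - 1) =
  Edet w n.+1 s * Edet w n.+1 (s - 1) - Edet w n.+1 (s + 1) * Edet w n.+1 (s - 2).
Proof.
rewrite !EdetE => E0; have s1 : s + 1 - 2 = s - 1 by ring.
by have := @desnanot_jacobi _ (fourier w) 1 (- 2) n s; rewrite s1 => ->.
Qed.

End FourierMoments.

(** * From the algebraic recurrences to [Rpoly] and [Sstar] *)

Theorem theorem4p2 (R : realType) (w : R[i] -> R[i])
    (w_int : circle_integrable w) (n : nat) (s : int) :
  ((forall m : nat, (n <= m <= n + 3)%N -> Edet w m s != 0) ->
   (forall m : nat, (n + 1 <= m <= n + 2)%N -> Edet w m (s - 1) != 0) ->
   (forall m : nat, (n <= m <= n + 2)%N -> Edet w m (s - 2) != 0) ->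
   Rpoly w (n + 3) s
   - ('X + (varkappa w (n + 2) s)%:P) * Rpoly w (n + 2) s
   + (varkappa w (n + 1) s + rho w (n + 1) (s - 1)
      + rho w (n + 2) s + varkappa w (n + 2) s)%:P * 'X * Rpoly w (n + 1) s
   - ((rho w (n + 2) s + varkappa w (n + 2) s)
      * (varkappa w n s + rho w n (s - 1)))%:P * 'X * Rpoly w n s = 0)
  /\
  ((forall m : nat, (n <= m <= n + 3)%N -> Edet w m s != 0) ->
   (forall m : nat, (n + 1 <= m <= n + 2)%N -> Edet w m (s + 1) != 0) ->
   Edet w (n + 1) (s + 2) != 0 ->
   Sstar w (n + 3) s
   - (gamma w (n + 2) s + gamma w (n + 1) (s + 1))%:P * 'X * Sstar w (n + 2) s
   - (1 - (gamma w (n + 1) (s + 1) * gamma w (n + 1) s)%:P * 'X^2)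
     * Sstar w (n + 1) s
   + (theta w (n + 1) (s + 1) + gamma w (n + 1) (s + 1))%:P * 'X
     * Sstar w n s = 0).
Proof.
rewrite !(addn1, addn2, addn3).
split=> E_neq0 F_neq0 G_neq0; have E0 : Edet w n s != 0 by apply: E_neq0; lia.
all: have E1 : Edet w n.+1 s != 0 by apply: E_neq0; lia.
all: have E2 : Edet w n.+2 s != 0 by apply: E_neq0; lia.
all: have E3 : Edet w n.+3 s != 0 by apply: E_neq0; lia.
all: [> have F1 : Edet w n.+1 (s - 1) != 0 by apply: F_neq0; lia
      | have F1 : Edet w n.+1 (s + 1) != 0 by apply: F_neq0; lia].
all: [> have F2 : Edet w n.+2 (s - 1) != 0 by apply: F_neq0; lia
      | have F2 : Edet w n.+2 (s + 1) != 0 by apply: F_neq0; lia].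
- have G0 : Edet w n (s - 2) != 0 by apply: G_neq0; lia.
  have G1 : Edet w n.+1 (s - 2) != 0 by apply: G_neq0; lia.
  have G2 : Edet w n.+2 (s - 2) != 0 by apply: G_neq0; lia.
  (* Regrouping the four-term coefficient into two pairs lets each pair be replaced by its product
     form. *)
  rewrite -(addrA (varkappa w n.+1 s + _)) !RpolyE //.
  have DJ := @Edet_desnanot_jacobi R w.
  have K0 := varkappa_add_rho DJ E0 E1 F1 G0; have K1 := varkappa_add_rho DJ E1 E2 F2 G1.
  have K2 := rho_add_varkappa DJ E2 E3 F1 F2 G2.
  rewrite /rho /varkappa /g K0 K1 K2.
  rewrite coef_R_product // invf_div mulf_div.
  by rewrite !EdetE recurrence_R -?EdetE.
- have DJ := @Edet_desnanot_jacobi R w.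
  have G1 : Edet w n.+1 (s + 2) != 0 by exact: G_neq0.
  have K1 := theta_add_gamma DJ E0 E1 F1 F2 G1; have K2 := gamma_mul_gamma E1 E2 F1 F2 G1.
  rewrite /Sstar !SpolyE // /theta /gamma /g K1 K2.
  have -> : s + 1 + 1 = s + 2 by ring.
  rewrite !invf_div !mulf_div -opprD.
  set x := _ + _ / _; set y := _ * _ / _; set z := _ * _ / _.
  pose P m := orth_poly (fourier w) (- 2) 1 m s.
  have sizeP m : Edet w m s != 0 -> size (P m) = m.+1.
    by move=> Em; apply: size_orth_poly; rewrite step_detC -EdetE.
  have : P n.+3 + x%:P * P n.+2 + y%:P * P n.+1 - 'X * ('X * P n.+1)
      - z%:P * ('X * ('X * P n)) = 0.
    by rewrite /x /y /z !EdetE ![step_det _ 1 _ _ _]step_detC recurrence_S // step_detC -EdetE.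
  (* All terms are reversed at degree [n.+3]. Each missing degree yields a factor ['X]: one for
     [P n.+2], two for [P n.+1], one for ['X * ('X * P n)], and none for ['X * ('X * P n.+1)]. *)
  rewrite !mul_polyC => /(congr1 (reciprocal n.+3)).
  rewrite reciprocal0 !(reciprocalD, reciprocalN, reciprocalZ, reciprocalXM).
  rewrite (reciprocal_widen (p := P n.+2)) ?sizeP //.
  rewrite (reciprocal_widen (n := n.+2) (p := P n.+1)) ?sizeP //.
  rewrite (reciprocal_widen (n := n.+1) (p := P n.+1)) ?sizeP //.
  rewrite (reciprocal_widen (n := n) (p := P n)) ?sizeP //.
  by rewrite -!mul_polyC !polyCN => recP; rewrite -[RHS]recP; ring.
Qed.
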